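(* Let $G$ be a finite group and $V$ a finite-dimensional $\mathbb{C}G$-module (not necessarily faithful) with character $\chi$. Let $g_1,\dots,g_N$ be representatives of the conjugacy classes $C_1,\dots,C_N$ of $G$, let $\chi_1,\dots,\chi_N$ be the irreducible complex characters of $G$, and let $S_t=\sum_{i=1}^N\chi_i(g_t)$. Let $b(n)$ be the number of irreducible summands of $V^{\otimes n}$, counted with multiplicity. Then $$b(n)=\frac{1}{|G|}\sum_{t=1}^N|C_t|\,S_t\,\big(\chi(g_t)\big)^n .$$ Moreover, with $a(n)$ the asymptotic growth rate of $V$ (as defined in the context): (1) $\left|b(n)/a(n)-1\right|\in\mathcal{O}\big((|\chi_{\mathrm{sec}}|/\dim V)^n\big)$; (2) $|b(n)-a(n)|\in\mathcal{O}\big(|\chi_{\mathrm{sec}}|^n\big)$.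
   Context: $S_t$ is the sum of the entries of the column of the character table corresponding to $g_t$. $\chi_{\mathrm{sec}}$ denotes any second largest value of $\chi$ in modulus, i.e. a value $\chi(g)$ of largest modulus among those with $|\chi(g)|<\chi(1)=\dim V$ (and $\chi_{\mathrm{sec}}=0$ if there is no such value). Definition of $a(n)$. For a group $H$ and a faithful $\mathbb{C}H$-module $W$, let $Z_W(H)$ be the subgroup of all $h\in H$ acting on $W$ by a scalar $\omega_W(h)$ (it is contained in the center of $H$), and put $$a(n)=\frac{1}{|H|}\sum_{h\in Z_W(H)}S_h\,\omega_W(h)^n\cdot(\dim W)^n,$$ where $S_h$ is the sum of the entries of the column of the character table of $H$ corresponding to $h$. If $V$ is faithful, $a(n)$ is this formula for $H=G$, $W=V$; if $V$ is not faithful, $a(n)$ is this formula for $V$ viewed as a faithful module over $H=G/\ker V$, where $\ker V$ is the subgroup acting trivially on $V$. *)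

(* Defs.v *)
Set Warnings "-notation-overridden,-ambiguous-paths,-notation-incompatible-prefix".
From HB Require Import structures.
From mathcomp Require Import all_boot all_order all_algebra all_fingroup.
From mathcomp Require Import all_solvable all_field all_character.

Set Implicit Arguments.
Unset Strict Implicit.
Unset Printing Implicit Defensive.

Import Order.TTheory GRing.Theory Num.Theory.

Local Open Scope group_scope.
Local Open Scope ring_scope.

(* A finite-dimensional F[G]-module V is given by a matrix representation
   rG : mx_representation F G d, with d = dim V.  The algC-valued characters of
   the character library are not used, so that F can be the field R[i] of
   complex numbers.                                                           *)

Section TensorPower.

Variables (F : fieldType) (gT : finGroupType) (G : {group gT}).

Lemma trivial_mx_repr : mx_repr G (fun _ : gT => 1%:M : 'M[F]_1).
Proof. by split=> // x y _ _; rewrite mulmx1. Qed.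

Definition trivial_repr := MxRepresentation trivial_mx_repr.

Fixpoint tensor_power (d : nat) (rG : mx_representation F G d) (n : nat) :
    representation F G :=
  if n is m.+1 then Representation (prod_repr rG (tensor_power rG m))
  else Representation trivial_repr.

Definition repr_char (d : nat) (rG : mx_representation F G d) (x : gT) : F :=
  \tr (rG x).

End TensorPower.

Section IrreducibleSummands.

Variables (F : decFieldType) (gT : finGroupType) (G : {group gT}).

(* The W range over the isotypic components, each a direct sum of
   socle_mult W copies of a simple module; see nb_irr_summandsE below.        *)
Definition nb_irr_summands (d : nat) (rG : mx_representation F G d) : nat :=
  (\sum_(W : DecSocleType rG) socle_mult W)%N.

Lemma nb_irr_summandsE (d : nat) (rG : mx_representation F G d)
    (I : finType) (U : I -> 'M[F]_d) :
    (forall i, mxsimple rG (U i)) ->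
    (\sum_i U i :=: 1%:M)%MS -> mxdirect (\sum_i U i) ->
  nb_irr_summands rG = #|I|.
Proof.
move=> simU defU dxU; set sG := DecSocleType rG.
have isoU i : {W : sG | mx_iso rG (socle_base W) (U i)} by apply: Socle_iso.
pose f i := sval (isoU i).
have rkU i : \rank (U i) = \rank (socle_base (f i)).
  by apply/esym/mxrank_iso; apply: (svalP (isoU i)).
have sUf i : (U i <= f i)%MS.
  exact: (mx_iso_component (socle_simple (f i)) (svalP (isoU i))).
have rk_gt0 (W : sG) : (0 < \rank (socle_base W))%N.
  by rewrite lt0n mxrank_eq0; case: (socle_simple W).
have rkS (W : sG) : (\sum_(i | f i == W) \rank (U i) =
    #|[pred i | f i == W]| * \rank (socle_base W))%N.
  by rewrite -sum_nat_const; apply: eq_bigr => i /eqP <-.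
have leS (W : sG) : (\sum_(i | f i == W) \rank (U i) <= \rank W)%N.
  have dxW : mxdirect (\sum_(i | f i == W) U i).
    apply/mxdirect_sumsP => i fi; apply/eqP; rewrite -submx0.
    have /mxdirect_sumsP /(_ i isT) dxi := dxU.
    rewrite -[X in (_ <= X)%MS]dxi capmxS //; apply/sumsmx_subP => j /andP[_ ji].
    exact: (sumsmx_sup j).
  move/mxdirectP: dxW => /= <-; apply: mxrankS.
  by apply/sumsmx_subP => i /eqP <-.
have sumS : (\sum_(W : sG) \sum_(i | f i == W) \rank (U i) = d)%N.
  move/mxdirectP: dxU => /=; rewrite defU mxrank1 => dE; apply: esym.
  by apply: etrans dE _; rewrite (partition_big f xpredT).
have sumW : (\sum_(W : sG) \rank W <= d)%N.
  by have /mxdirectP /= <- := Socle_direct sG; apply: rank_leq_col.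
have eqS (W : sG) : (\sum_(i | f i == W) \rank (U i) = \rank W)%N.
  apply/eqP; rewrite eqn_leq leS leqNgt; apply/negP => ltW.
  have: (\sum_(W' : sG) \sum_(i | f i == W') \rank (U i) <
         \sum_(W' : sG) \rank W')%N.
    rewrite (bigD1 W) //= [X in (_ < X)%N](bigD1 W) //= -addSn leq_add //.
    by apply: leq_sum => W' _; apply: leS.
  by rewrite sumS ltnNge sumW.
rewrite /nb_irr_summands -sum1_card (partition_big f xpredT) //=.
apply: eq_bigr => W _; rewrite /socle_mult -eqS rkS mulnK //.
by rewrite sum1_card.
Qed.

End IrreducibleSummands.

Section Growth.

Variables (C : numClosedFieldType).

(* S_g: the irreducible C-characters of G are the traces of the irr_repr i, for
   i ranging over the components of the regular module, as for 'chi[G]_i over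
   algC.                                                                      *)
Definition irr_col_sum (gT : finGroupType) (G : {group gT}) (g : gT) : C :=
  \sum_(i : DecSocleType (regular_repr C G)) \tr (irr_repr i g).

(* The scalar by which h acts when h \in rcenter rH, see scalar_actE; it is
   read off the first diagonal entry, the value for d = 0 being immaterial.   *)
Definition scalar_act (gT : finGroupType) (H : {group gT}) (d : nat)
    (rH : mx_representation C H d) (h : gT) : C :=
  if insub 0%N is Some i then rH h i i else 1.

Lemma scalar_actE (gT : finGroupType) (H : {group gT}) (d : nat)
    (rH : mx_representation C H d) (h : gT) :
  h \in rcenter rH -> rH h = (scalar_act rH h)%:M.
Proof.
case/setIdP=> _; rewrite /is_scalar_mx /scalar_act.
case: insubP => [i _ _ /eqP // | ] ; rewrite -eqn0Ngt => /eqP d0 _.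
by apply/matrixP => i; have := ltn_ord i; rewrite [X in (_ < X)%N]d0.
Qed.

(* rcenter rH is the subgroup of all h in H acting by a scalar. *)
Definition faithful_growth_rate (gT : finGroupType) (H : {group gT}) (d : nat)
    (rH : mx_representation C H d) (n : nat) : C :=
  #|H|%:R^-1 *
  \sum_(h in rcenter rH)
     irr_col_sum H h * scalar_act rH h ^+ n * d%:R ^+ n.

(* kquo_repr rG is V as a (faithful) module over G / rker rG. *)
Definition growth_rate (gT : finGroupType) (G : {group gT}) (d : nat)
    (rG : mx_representation C G d) (n : nat) : C :=
  if mx_faithful rG then faithful_growth_rate rG n
  else faithful_growth_rate (kquo_repr rG) n.

Definition second_largest_value (gT : finGroupType) (G : {group gT}) (d : nat)
    (rG : mx_representation C G d) (c : C) : Prop :=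
  let small g := g \in G /\ `|repr_char rG g| < d%:R in
  (exists g, [/\ small g, c = repr_char rG g &
     forall h, small h -> `|repr_char rG h| <= `|c| ])
  \/ (~ (exists g, small g) /\ c = 0).

End Growth.

(* Main.v *)
Require Import Defs.
Set Warnings "-notation-overridden,-ambiguous-paths,-notation-incompatible-prefix".
From HB Require Import structures.
From mathcomp Require Import all_boot all_order all_algebra all_fingroup.
From mathcomp Require Import all_solvable all_field all_character.
From mathcomp Require Import complex.
From mathcomp Require Import all_classical all_reals all_analysis.

Set Implicit Arguments.
Unset Strict Implicit.
Unset Printing Implicit Defensive.

Import Order.TTheory GRing.Theory Num.Theory.
Import numFieldNormedType.Exports.

Local Open Scope classical_set_scope.
Local Open Scope group_scope.
Local Open Scope ring_scope.

(** Over the complex numbers, G-modules are completely reducible and the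
    irreducible characters are orthogonal. Consequently the linear form
    psi |-> #|G|^-1 * sum over g of S_g * psi(g) takes the value 1 at every
    irreducible character: S is the sum of all irreducible characters, complex
    conjugation permutes these, and so exactly one of them pairs nontrivially
    with a given one ([sum_irr_col_sum_irr]). The form therefore counts the
    irreducible summands of any module ([nb_irr_summands_char]), and for a
    tensor power, whose character is a power of that of V, this is the formula
    for b(n).

    A matrix of finite order is diagonalisable with eigenvalues of modulus 1,
    so |chi(g)| = dim V exactly when g acts by a scalar ([repr_char_norm_lt]).
    In the formula for b(n), the elements acting by scalars contribute a(n), and
    the others are bounded by the second largest modulus: this is the absolute
    error estimate ([growth_rate_error]). If V is not faithful, the same
    computation is made in the quotient by the kernel, which changes neither the
    number of summands ([nb_irr_summands_quotient]) nor the set of values of the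
    character.

    For the relative error it remains to bound a(n) from below by a multiple of
    (dim V)^n. An irreducible module has dimension at most #|G|, so
    b(n) >= (dim V)^n / #|G| ([nb_irr_tensor_power_ge]), and the difference
    b(n) - a(n) is negligible compared with (dim V)^n. *)

(** * Matrices of finite order over a closed field with conjugation *)

Section FiniteOrder.

Variable C : numClosedFieldType.

(** The minimal polynomial divides 'X^m - 1, which splits with simple roots. *)
Lemma diagonalizable_finite_order n m (A : 'M[C]_n.+1) :
  (0 < m)%N -> A ^+ m = 1 -> diagonalizable A.
Proof.
move=> m_gt0 Am1; apply/diagonalizableP.
have [rs Drs] := closed_field_poly_normal ('X^m - 1 : {poly C}).
have mon : ('X^m - 1 : {poly C}) \is monic by rewrite monicXnsubC.
move: Drs; rewrite (monicP mon) scale1r => Drs.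
exists rs.
  rewrite -separable_prod_XsubC -Drs.
  by apply: separable_Xn_sub_1; rewrite pnatr_eq0 -lt0n.
rewrite -Drs; apply: mxminpoly_min.
by rewrite rmorphB rmorphXn rmorph1 /= horner_mx_X Am1 subrr.
Qed.

Variables (gT : finGroupType) (G : {group gT}).

Lemma pchar'G : [pchar C]^'.-group G.
Proof. by apply/pgroupP=> p _; rewrite inE /= pchar_num. Qed.

(** The eigenvalues are roots of unity, so they have modulus 1: this gives both
    the value of the character at an inverse and the triangle inequality that
    separates the scalar elements from the others. *)
Lemma repr_unit_eigenvalues n (rG : mx_representation C G n) x : x \in G ->
  exists (P : 'M[C]_n) (e : 'rV[C]_n), [/\ P \in unitmx,
     rG x = invmx P *m diag_mx e *m P & forall i, `|e 0 i| = 1].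
Proof.
case: n rG => [|n] rG Gx.
  exists 1%:M, 0; split=> [||[]//]; rewrite ?unitmx1 //.
  by rewrite [LHS]thinmx0 [RHS]thinmx0.
have powE k : rG x ^+ k = rG (x ^+ k)%g.
  elim: k => [|k IHk]; first by rewrite expg0 repr_mx1.
  by rewrite exprS IHk expgS repr_mxM ?groupX.
have o1 : rG x ^+ #[x]%g = 1 by rewrite powE expg_order repr_mx1.
have [P uP /(diagonalizable_forLR uP)[e]] :=
  diagonalizable_finite_order (order_gt0 x) o1.
rewrite mxpoly.conjVmx // => De; exists P, e; split=> // i.
have De' : diag_mx e = P *m rG x *m invmx P.
  by rewrite De !mulmxA mulmxV // mul1mx mulmxK.
have /matrixP/(_ i i) : (diag_mx e) ^+ #[x]%g = 1.
  have expP k : (P *m rG x *m invmx P) ^+ k = P *m rG x ^+ k *m invmx P.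
    elim: k => [|k IHk]; first by rewrite !expr0 mulmx1 mulmxV.
    by rewrite !exprS IHk -!mulmxE !mulmxA mulmxKV.
  by rewrite De' expP o1 mulmx1 mulmxV.
have diagX k : (diag_mx e) ^+ k = diag_mx (\row_j (e 0 j ^+ k)).
  elim: k => [|k IHk].
    by rewrite expr0; apply/matrixP=> j l; rewrite !mxE expr0.
  rewrite exprS IHk -mulmxE mulmx_diag; congr diag_mx.
  by apply/rowP=> j; rewrite !mxE exprS.
rewrite diagX !mxE eqxx => /(congr1 Num.norm).
rewrite normrX normr1 => /eqP; rewrite pexpr_eq1 ?order_gt0 //.
by move/eqP.
Qed.

(** An eigenvalue of modulus 1 is inverted by conjugation. *)
Lemma repr_char_inv n (rG : mx_representation C G n) x : x \in G ->
  repr_char rG x^-1%g = (repr_char rG x)^*.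
Proof.
move=> Gx; have [P [e [uP De e1]]] := repr_unit_eigenvalues rG Gx.
have ->: repr_char rG x = \sum_i e 0 i.
  by rewrite /repr_char De mxtrace_mulC mulmxA mulmxV // mul1mx mxtrace_diag.
pose f := map_mx Num.conj e.
rewrite [LHS]/repr_char.
transitivity (\sum_i f 0 i); last first.
  by rewrite rmorph_sum; apply: eq_bigr => i _; rewrite mxE.
(* The conjugate eigenvalues f in the same basis give the inverse matrix. *)
have ef : (invmx P *m diag_mx e *m P) *m (invmx P *m diag_mx f *m P) = 1%:M.
  rewrite !mulmxA mulmxK // -!mulmxA (mulmxA (diag_mx e)) mulmx_diag.
  suff -> : \row_j (e 0 j * f 0 j) = const_mx 1.
    by rewrite diag_const_mx mul1mx mulVmx.
  by apply/rowP=> j; rewrite !mxE -normCK e1 expr1n.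
have ->: rG x^-1%g = invmx P *m diag_mx f *m P.
  rewrite repr_mxV // -[LHS]mulmx1 -ef -De; exact/mulKmx/repr_mx_unit.
by rewrite mxtrace_mulC mulmxA mulmxV // mul1mx mxtrace_diag.
Qed.

(** Equality in the triangle inequality for a sum of n numbers of modulus 1
    forces them all to be equal, and then the diagonalised matrix is scalar. *)
Lemma repr_char_norm_lt n (rG : mx_representation C G n) x : x \in G ->
  x \notin rcenter rG -> `|repr_char rG x| < n%:R.
Proof.
move=> Gx; have [P [e [uP De e1]]] := repr_unit_eigenvalues rG Gx.
have sume1 : \sum_i `|e 0 i| = n%:R.
  by rewrite (eq_bigr _ (in1W e1)) sumr_const card_ord.
rewrite inE Gx /= => nscal.
have ->: repr_char rG x = \sum_i e 0 i.
  by rewrite /repr_char De mxtrace_mulC mulmxA mulmxV // mul1mx mxtrace_diag.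
rewrite lt_neqAle -{2}sume1 ler_norm_sum andbT -sume1.
apply: contraNneq nscal => /normC_sum_eq1[//|t _ De1].
rewrite De (_ : e = const_mx t); last by apply/rowP=> i; rewrite De1 ?mxE.
by rewrite diag_const_mx scalar_mxC mulmxKV // scalar_mx_is_scalar.
Qed.

End FiniteOrder.

(** * Orthogonality of the irreducible characters *)

Section Orthogonality.

Variables (C : numClosedFieldType) (gT : finGroupType) (G : {group gT}).

(** Averaging an arbitrary matrix over G makes it G-equivariant, so that Schur's
    lemma applies; the matrix units then extract the products of diagonal
    entries that make up the inner product of two characters. *)
Definition average_intertwiner m n (rU : mx_representation C G m)
    (rV : mx_representation C G n) (A : 'M[C]_(m, n)) : 'M[C]_(m, n) :=
  \sum_(g in G) rU g^-1%g *m A *m rV g.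

Lemma average_intertwiner_equivariant m n (rU : mx_representation C G m)
    (rV : mx_representation C G n) A x : x \in G ->
  let B := average_intertwiner rU rV A in rU x *m B = B *m rV x.
Proof.
move=> Gx; rewrite /= /average_intertwiner mulmx_sumr mulmx_suml.
rewrite (reindex_inj (mulIg x)); apply: eq_big => g; first by rewrite groupMr.
rewrite groupMr // => Gg; rewrite invMg !repr_mxM ?groupV //.
by rewrite !mulmxA -repr_mxM ?groupV // mulgV repr_mx1 mul1mx.
Qed.

(** Schur's lemma between two representations: the kernel of a nonzero
    intertwiner is 0 and its image is everything. *)
Lemma average_intertwiner0 m n (rU : mx_representation C G m)
    (rV : mx_representation C G n) A :
    mx_irreducible rU -> mx_irreducible rV -> ~ mx_rsim rU rV ->
  average_intertwiner rU rV A = 0.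
Proof.
move=> /mx_irrP[_ irrU] /mx_irrP[_ irrV] nUV; apply/eqP/negPn/negP => nzB.
have homB := @average_intertwiner_equivariant _ _ rU rV A.
set B := average_intertwiner rU rV A in nzB homB.
have freeB : row_free B.
  rewrite -kermx_eq0; apply: contraNT nzB => nzK.
  have/irrU/(_ nzK): mxmodule rU (kermx B).
    apply/mxmoduleP=> x Gx; apply/sub_kermxP.
    by rewrite -mulmxA homB // mulmxA mulmx_ker mul0mx.
  by rewrite -sub1mx => /sub_kermxP; rewrite mul1mx => ->.
have fullB : row_full B.
  rewrite /row_full -(genmxE B); apply: irrV.
    rewrite (eqmx_module _ (genmxE B)); apply/mxmoduleP=> x Gx.
    by rewrite -homB // submxMl.
  by rewrite (eqmx_eq0 (genmxE B)).
case: nUV; exists B => //.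
by rewrite -(eqP freeB) (eqP fullB).
Qed.

Lemma sum_mxtrace_average m n (rU : mx_representation C G m)
    (rV : mx_representation C G n) :
  \sum_(g in G) \tr (rU g^-1%g) * \tr (rV g) =
  \sum_k \sum_l average_intertwiner rU rV (delta_mx k l) k l.
Proof.
pose f g k l := rU g^-1%g k k * rV g l l.
transitivity (\sum_(g in G) \sum_k \sum_l f g k l).
  apply: eq_bigr => g _; rewrite /mxtrace mulr_suml; apply: eq_bigr => k _.
  by rewrite mulr_sumr.
rewrite exchange_big; apply: eq_bigr => k _; rewrite exchange_big.
apply: eq_bigr => l _; rewrite summxE; apply: eq_bigr => g _.
rewrite /f -(mul_delta_mx (0 : 'I_1)) mulmxA -mulmxA -colE -rowE.
by rewrite mxE big_ord1 !mxE.
Qed.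

Lemma mxtrace_delta m (k l : 'I_m) :
  \tr (delta_mx k l : 'M[C]_m) = (k == l)%:R.
Proof.
rewrite -(mul_delta_mx (0 : 'I_1)) mxtrace_mulC mul_delta_mx_cond trace_mx11.
by rewrite mulmxnE mxE !eqxx eq_sym.
Qed.

Lemma irr_abs_irr n (rG : mx_representation C G n) :
  mx_irreducible rG -> mx_absolutely_irreducible rG.
Proof. exact: group_closure_closed_field. Qed.

(** By Schur's lemma the average of the matrix unit (k, l) is a scalar matrix,
    and its trace #|G| * (k == l) determines the scalar. *)
Lemma sum_mxtrace_irr_self m (rU : mx_representation C G m) :
    mx_irreducible rU ->
  \sum_(g in G) \tr (rU g^-1%g) * \tr (rU g) = #|G|%:R.
Proof.
move=> irrU; have m_gt0 : (0 < m)%N by case/mx_irrP: irrU.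
have nz_m : m%:R != 0 :> C by rewrite pnatr_eq0 -lt0n.
have avg k l : average_intertwiner rU rU (delta_mx k l) =
    (#|G|%:R / m%:R * (k == l)%:R)%:M.
  have /is_scalar_mxP[c Dc] :
      is_scalar_mx (average_intertwiner rU rU (delta_mx k l)).
    apply: (mx_abs_irr_cent_scalar (irr_abs_irr irrU)).
    by apply/centgmxP=> x Gx; rewrite average_intertwiner_equivariant.
  rewrite Dc; congr _%:M; apply: (mulIf nz_m).
  rewrite mulrAC divfK // mulr_natr -mxtrace_scalar -Dc /average_intertwiner.
  rewrite raddf_sum -mxtrace_delta -sumr_const mulr_suml.
  apply: eq_bigr => g Gg; rewrite mul1r /= mxtrace_mulC mulmxA.
  by rewrite -repr_mxM ?groupV // mulgV repr_mx1 mul1mx.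
rewrite sum_mxtrace_average (eq_bigr (fun _ => #|G|%:R / m%:R)) => [|k _].
  by rewrite sumr_const card_ord -[LHS]mulr_natr divfK.
rewrite (bigD1 k) //= avg !mxE !eqxx !mulr1n mulr1 big1 ?addr0 // => l.
by rewrite avg mxE eq_sym => /negPf->.
Qed.

Variable sG : irrType C G.

Lemma sum_mxtrace_irr m n (rU : mx_representation C G m)
    (rV : mx_representation C G n) : mx_irreducible rU -> mx_irreducible rV ->
  \sum_(g in G) \tr (rU g^-1%g) * \tr (rV g) =
    #|G|%:R * (irr_comp sG rU == irr_comp sG rV)%:R.
Proof.
move=> irrU irrV; have sU := rsim_irr_comp_pchar sG (pchar'G C G) irrU.
have sV := rsim_irr_comp_pchar sG (pchar'G C G) irrV.
case: eqP => [Duv | nUV]; last first.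
  rewrite sum_mxtrace_average mulr0 !big1 // => k _; rewrite big1 // => l _.
  rewrite average_intertwiner0 ?mxE // => /(irr_comp_rsim_pchar sG).
  by move/(_ (pchar'G C G)).
rewrite mulr1 -(sum_mxtrace_irr_self irrU); apply: eq_bigr => g Gg.
by rewrite (mxtrace_rsim sU Gg) Duv (mxtrace_rsim sV Gg).
Qed.

(** Entrywise conjugation of a representation plays the role of the dual: over
    an algebraically closed field it preserves irreducibility. *)
Definition irr_conj (i : sG) : sG :=
  irr_comp sG (map_repr Num.conj (irr_repr i)).

Lemma map_conj_irr n (rG : mx_representation C G n) :
  mx_irreducible rG -> mx_irreducible (map_repr Num.conj rG).
Proof.
by move=> irrG; apply: mx_abs_irrW; rewrite map_mx_abs_irr irr_abs_irr.
Qed.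

Lemma irr_conjK : involutive irr_conj.
Proof.
move=> i; rewrite -[RHS](irr_reprK_pchar (pchar'G C G)).
have irrc := map_conj_irr (socle_irr i).
have /(mx_rsim_map Num.conj) := rsim_irr_comp_pchar sG (pchar'G C G) irrc.
move/mx_rsim_sym/(irr_comp_rsim_pchar sG (pchar'G C G)).
rewrite /irr_conj => ->; apply: irr_comp_rsim_pchar; first exact: pchar'G.
exists 1%:M => // [|x Gx]; first by rewrite row_free_unit unitmx1.
rewrite mulmx1 mul1mx; apply/matrixP=> k l; rewrite !mxE.
exact: conjCK.
Qed.

End Orthogonality.

(** * Counting irreducible summands by characters *)

(** The product is not conjugated, so the summand of index i in the column sum
    contributes exactly when the conjugate of i is the class of rU; conjugation
    being a bijection of the irreducible representations, this happens once. *)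
Lemma sum_irr_col_sum_irr (C : numClosedFieldType) (gT : finGroupType)
    (G : {group gT}) n (rU : mx_representation C G n) : mx_irreducible rU ->
  \sum_(g in G) irr_col_sum C G g * \tr (rU g) = #|G|%:R.
Proof.
move=> irrU; set sG := DecSocleType (regular_repr C G).
under eq_bigr do rewrite /irr_col_sum mulr_suml.
rewrite exchange_big /= (eq_bigr (fun i : sG =>
   #|G|%:R * (irr_conj i == irr_comp sG rU)%:R)) => [|i _].
  rewrite (bigD1 (irr_conj (irr_comp sG rU))) //= irr_conjK eqxx mulr1.
  rewrite big1 ?addr0 // => i; rewrite (inv_eq (@irr_conjK _ _ _ sG)).
  by move/negPf->; rewrite mulr0.
rewrite -sum_mxtrace_irr //; last exact/map_conj_irr/socle_irr.
apply: eq_bigr => g Gg; congr (_ * _).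
rewrite trace_map_mx -[RHS]/((repr_char (irr_repr i) g^-1%g)^*).
by rewrite repr_char_inv ?conjCK.
Qed.

(** By complete reducibility the socle is the whole module. *)
Lemma repr_char_Socle (C : numClosedFieldType) (gT : finGroupType)
    (G : {group gT}) n (rG : mx_representation C G n) x : x \in G ->
  repr_char rG x =
    \sum_(W : DecSocleType rG) repr_char (socle_repr W) x *+ socle_mult W.
Proof.
move=> Gx; rewrite -mxtrace_Socle //; symmetry; apply: mxtrace_submod1 => //.
by rewrite reducible_Socle1 //; exact/mx_Maschke_pchar/pchar'G.
Qed.

(** The right-hand side is additive in the representation, so it counts summands
    as soon as it equals 1 on irreducible ones. The map phi serves twice, as the
    identity of G and as the projection onto a quotient. *)
Lemma nb_irr_summands_pullback (C : numClosedFieldType)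
    (gT hT : finGroupType) (G : {group gT}) (H : {group hT}) (phi : gT -> hT)
    n (rH : mx_representation C H n) :
    {in G, forall g, phi g \in H} ->
    (forall m (rU : mx_representation C H m), mx_irreducible rU ->
       \sum_(g in G) irr_col_sum C G g * repr_char rU (phi g) = #|G|%:R) ->
  (nb_irr_summands rH)%:R =
    #|G|%:R^-1 * \sum_(g in G) irr_col_sum C G g * repr_char rH (phi g).
Proof.
move=> phiH sum_irr; set sH := DecSocleType rH.
rewrite (eq_bigr (fun g => \sum_(W : sH)
   (irr_col_sum C G g * repr_char (socle_repr W) (phi g)) *+ socle_mult W)).
  rewrite exchange_big /= (eq_bigr (fun W : sH => #|G|%:R *+ socle_mult W)).
    by rewrite sumrMnr mulrnAr mulVf // pnatr_eq0 -lt0n cardG_gt0.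
  move=> W _; rewrite sumrMnl; congr (_ *+ _).
  by rewrite sum_irr //; apply: socle_irr.
move=> g Gg; rewrite repr_char_Socle ?phiH // mulr_sumr.
by apply: eq_bigr => W _; rewrite mulrnAr.
Qed.

Lemma nb_irr_summands_char (C : numClosedFieldType) (gT : finGroupType)
    (G : {group gT}) n (rG : mx_representation C G n) :
  (nb_irr_summands rG)%:R =
    #|G|%:R^-1 * \sum_(g in G) irr_col_sum C G g * repr_char rG g.
Proof.
by apply: (@nb_irr_summands_pullback _ _ _ _ _ id) => // m rU
  /sum_irr_col_sum_irr.
Qed.

(** A module over G / K has as many irreducible summands over G, since inflation
    preserves irreducibility. The hypothesis compares characters rather than
    matrices because the two tensor powers to which it is applied have degrees
    that are equal but not convertible. *)
Lemma nb_irr_summands_quotient (C : numClosedFieldType) (gT : finGroupType)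
    (G K : {group gT}) (nKG : G \subset 'N(K)) n m
    (rG : mx_representation C G n) (rH : mx_representation C (G / K) m) :
    {in G, forall g, repr_char rG g = repr_char rH (coset K g)} ->
  nb_irr_summands rG = nb_irr_summands rH.
Proof.
move=> eq_char; apply/eqP; rewrite -(eqr_nat C) nb_irr_summands_char.
rewrite (nb_irr_summands_pullback (G := G) (phi := coset K)).
- by apply/eqP; congr (_ * _); apply: eq_bigr => g /eq_char->.
- by move=> g Gg; rewrite mem_quotient.
move=> k rU irrU.
rewrite -(@sum_irr_col_sum_irr C gT G _ (morphim_repr rU nKG)) //.
exact/morphim_mx_irr.
Qed.

(** * Sums over conjugacy classes *)

Lemma sum_class_representatives (K : nzRingType) (gT : finGroupType)
    (G : {group gT}) (N : nat) (g : 'I_N -> gT) (F : gT -> K) :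
    injective (fun t => g t ^: G) ->
    [set g t ^: G | t : 'I_N]%SET = classes G ->
    {in G &, forall x y, F (x ^ y)%g = F x} ->
  \sum_(x in G) F x = \sum_(t < N) #|g t ^: G|%:R * F (g t).
Proof.
move=> g_inj g_cls Fcls; rewrite sum_by_classes // -g_cls.
rewrite big_imset /=; last first.
  by move=> s t _ _; apply: g_inj.
apply: eq_bigr => t _; have Gt : g t \in G.
  have: g t ^: G \in classes G by rewrite -g_cls; apply/imsetP; exists t.
  case/imsetP=> x Gx Dx; have := class_refl G (g t).
  rewrite Dx => /imsetP[y Gy ->].
  by rewrite groupJ.
by have [y Gy ->] := repr_class G (g t); rewrite Fcls.
Qed.

Lemma repr_charJ (F : fieldType) (gT : finGroupType) (G : {group gT}) n
    (rG : mx_representation F G n) :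
  {in G &, forall x y, repr_char rG (x ^ y)%g = repr_char rG x}.
Proof.
move=> x y Gx Gy; rewrite /repr_char conjgE !repr_mxM ?groupM ?groupV //.
by rewrite mxtrace_mulC repr_mxK.
Qed.

Lemma irr_col_sumJ (C : numClosedFieldType) (gT : finGroupType)
    (G : {group gT}) :
  {in G &, forall x y, irr_col_sum C G (x ^ y)%g = irr_col_sum C G x}.
Proof.
move=> x y Gx Gy; apply: eq_bigr => i _; exact: (repr_charJ (irr_repr i)).
Qed.

(** * Tensor powers and the growth rate *)

Section TensorPowers.

Variables (C : numClosedFieldType) (gT : finGroupType) (G : {group gT}).

Lemma repr_char1 n (rG : mx_representation C G n) : repr_char rG 1%g = n%:R.
Proof. by rewrite /repr_char repr_mx1 mxtrace1. Qed.

(** An irreducible module is isomorphic to a submodule of the regular one. *)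
Lemma irr_degree_le_card n (rG : mx_representation C G n) :
  mx_irreducible rG -> (n <= #|G|)%N.
Proof.
move/(rsim_irr_comp_pchar (DecSocleType (regular_repr C G)) (pchar'G C G)).
by move/mxrank_rsim=> ->; apply: rank_leq_col.
Qed.

Lemma degree_le_nb_irr_summands n (rG : mx_representation C G n) :
  (n <= #|G| * nb_irr_summands rG)%N.
Proof.
rewrite -(ler_nat C) -(repr_char1 rG) repr_char_Socle //.
rewrite /nb_irr_summands mulnC big_distrl /= natr_sum; apply: ler_sum => W _.
rewrite repr_char1 -[leLHS]mulr_natl -natrM ler_nat leq_mul2l.
by rewrite (irr_degree_le_card (socle_irr W)) orbT.
Qed.

Variables (d : nat) (rG : mx_representation C G d).

Lemma repr_char_tensor_power n x :
  repr_char (tensor_power rG n) x = repr_char rG x ^+ n.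
Proof.
elim: n => [|n IHn]; first by rewrite /repr_char /= mxtrace1.
by rewrite exprS -IHn /repr_char /= mxtrace_prod.
Qed.

Let b n := nb_irr_summands (tensor_power rG n).

Lemma nb_irr_tensor_power n : (b n)%:R =
  #|G|%:R^-1 * \sum_(g in G) irr_col_sum C G g * repr_char rG g ^+ n.
Proof.
rewrite /b nb_irr_summands_char; congr (_ * _); apply: eq_bigr => g _.
by rewrite repr_char_tensor_power.
Qed.

Lemma nb_irr_tensor_power_ge n : d%:R ^+ n <= #|G|%:R * (b n)%:R :> C.
Proof.
rewrite -(repr_char1 rG) -repr_char_tensor_power repr_char1 -natrM ler_nat.
exact: degree_le_nb_irr_summands.
Qed.

Lemma repr_char_rcenter g : g \in rcenter rG ->
  repr_char rG g = scalar_act rG g * d%:R.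
Proof.
by move=> Zg; rewrite /repr_char scalar_actE // mxtrace_scalar mulr_natr.
Qed.

(** The elements acting by scalars contribute exactly the growth rate to the
    character formula, and each of the others has a character value bounded
    by c. *)
Lemma faithful_growth_rate_error (c : C) n : 0 <= c ->
    {in G, forall g, `|repr_char rG g| < d%:R -> `|repr_char rG g| <= c} ->
  `|(b n)%:R - faithful_growth_rate rG n| <=
    (#|G|%:R^-1 * \sum_(g in G) `|irr_col_sum C G g|) * c ^+ n.
Proof.
move=> c_ge0 le_c; set S := irr_col_sum C G.
have ->: (b n)%:R - faithful_growth_rate rG n =
    #|G|%:R^-1 * \sum_(g in G | g \notin rcenter rG) S g * repr_char rG g ^+ n.
  rewrite nb_irr_tensor_power /faithful_growth_rate -mulrBr; congr (_ * _).
  apply/eqP; rewrite subr_eq addrC (bigID (mem (rcenter rG))) /=; apply/eqP.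
  congr (_ + _); apply: eq_big => [g | g /andP[_ Zg]].
    by rewrite andb_idl // => /setIdP[].
  by rewrite repr_char_rcenter // exprMn mulrA.
rewrite normrM ger0_norm ?invr_ge0 ?ler0n // -mulrA ler_wpM2l ?invr_ge0 //.
rewrite mulr_suml; apply: le_trans (ler_norm_sum _ _ _) _.
rewrite [leRHS](bigID (fun g => g \notin rcenter rG)) /= -[leLHS]addr0 lerD //.
  apply: ler_sum => g /andP[Gg nZg]; rewrite normrM normrX ler_wpM2l //.
  by apply: lerXn2r; rewrite ?nnegrE ?le_c ?repr_char_norm_lt.
by apply: sumr_ge0 => g _; rewrite mulr_ge0 ?exprn_ge0.
Qed.

End TensorPowers.

(** In the unfaithful case, the values of the character on G and on G / rker rG
    are the same, so that one bound c serves for both groups. *)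
Lemma growth_rate_error (C : numClosedFieldType) (gT : finGroupType)
    (G : {group gT}) d (rG : mx_representation C G d) (c : C) :
    second_largest_value rG c ->
  exists2 K : C, 0 <= K & forall n,
    `|(nb_irr_summands (tensor_power rG n))%:R - growth_rate rG n|
      <= K * `|c| ^+ n.
Proof.
move=> c_sec.
have le_c : {in G, forall g, `|repr_char rG g| < d%:R ->
    `|repr_char rG g| <= `|c|}.
  case: c_sec => [[g [_ _ max_c]] | [no_small _]] h Gh lt_h; first exact: max_c.
  by case: no_small; exists h.
have bound_ge0 (hT : finGroupType) (H : {group hT}) :
    0 <= #|H|%:R^-1 * \sum_(h in H) `|irr_col_sum C H h|.
  by rewrite mulr_ge0 ?invr_ge0 ?ler0n //; apply: sumr_ge0.
rewrite /growth_rate; case: (mx_faithful rG).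
  exists (#|G|%:R^-1 * \sum_(h in G) `|irr_col_sum C G h|) => // n.
  exact: faithful_growth_rate_error.
set H := (G / rker rG)%G.
have char_coset : {in G, forall g,
    repr_char (kquo_repr rG) (coset (rker rG) g) = repr_char rG g}.
  by move=> g Gg; rewrite /repr_char kquo_repr_coset.
exists (#|H|%:R^-1 * \sum_(h in H) `|irr_col_sum C H h|) => // n.
rewrite (nb_irr_summands_quotient (rker_norm rG)
           (rH := tensor_power (kquo_repr rG) n)).
  apply: faithful_growth_rate_error => // _ /morphimP[g _ Gg ->].
  by rewrite char_coset //; apply: le_c.
by move=> g Gg; rewrite !repr_char_tensor_power char_coset.
Qed.

Lemma second_largest_value_lt (C : numClosedFieldType) (gT : finGroupType)
    (G : {group gT}) d (rG : mx_representation C G d) (c : C) :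
  (0 < d)%N -> second_largest_value rG c -> `|c| < d%:R.
Proof.
by move=> d_gt0 [[g [[_ ltg] -> _]] | [_ ->]] //; rewrite normr0 ltr0n.
Qed.

(** * Asymptotics over the complex numbers *)

(** The numbers involved are real, which reduces the claim to geometric
    sequences in R. *)
Lemma near_expr_le (R : realType) (q e : R[i]) : 0 <= q < 1 -> 0 < e ->
  \forall n \near \oo, q ^+ n <= e.
Proof.
case/andP=> q_ge0 q_lt1 e_gt0.
have Dq : q = (complex.Re q)%:C%C by apply/esym/RRe_real/ger0_real.
have De : e = (complex.Re e)%:C%C by apply/esym/RRe_real/gtr0_real.
have r_ge0 : 0 <= complex.Re q by rewrite -lecR -Dq.
have r1 : `|complex.Re q| < 1 by rewrite ger0_norm // -ltcR -Dq.
have re_gt0 : 0 < complex.Re e by rewrite -ltcR -De.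
have /(_ _) := cvgr0_norm_le _ (cvg_expr r1) _ re_gt0.
apply: filterS => n.
by rewrite ger0_norm ?exprn_ge0 // -lecR rmorphXn /= -Dq -De.
Qed.

Lemma eqO_near_le (R : realType) (f g : nat -> R[i]) (K : R[i]) :
    0 < K -> (forall n, 0 <= f n) -> (forall n, 0 <= g n) ->
    (\forall n \near \oo, f n <= K * g n) ->
  (f : nat -> R[i]^o) =O_\oo (g : nat -> R[i]^o).
Proof.
move=> K_gt0 f_ge0 g_ge0 le_fg; apply/eqO_exP; exists K => //=.
apply: filterS le_fg => n.
by rewrite (ger0_norm (f_ge0 n)) (ger0_norm (g_ge0 n)).
Qed.

Theorem theorem3 (R : realType) (gT : finGroupType) (G : {group gT}) (d : nat)
    (rG : mx_representation R[i] G d) (N : nat) (g : 'I_N -> gT)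
    (g_inj : injective (fun t => g t ^: G))
    (g_cls : [set g t ^: G | t : 'I_N]%SET = classes G) :
  let chi := repr_char rG in
  let b := fun n => nb_irr_summands (tensor_power rG n) in
  let a := growth_rate rG in
  (forall n, (b n)%:R =
     #|G|%:R^-1 *
     \sum_(t < N) #|g t ^: G|%:R * irr_col_sum R[i] G (g t) * chi (g t) ^+ n) /\
  (forall chi_sec : R[i], second_largest_value rG chi_sec ->
     ((0 < d)%N ->
        (fun n => `|(b n)%:R / a n - 1| : R[i]^o) =O_\oo
        (fun n => (`|chi_sec| / d%:R) ^+ n : R[i]^o)) /\
     (fun n => `|(b n)%:R - a n| : R[i]^o) =O_\oo
     (fun n => `|chi_sec| ^+ n : R[i]^o)).
Proof.
move=> chi b a; split=> [n | c c_sec].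
  rewrite /b nb_irr_tensor_power; congr (_ * _).
  rewrite (sum_class_representatives g_inj g_cls) => [|x y Gx Gy].
    by apply: eq_bigr => t _; rewrite mulrA.
  by rewrite irr_col_sumJ // repr_charJ.
(* K may be 0 while a domination constant must be positive, hence K + 1. *)
have [K K_ge0 errK] := growth_rate_error c_sec.
split=> [d_gt0 | ]; last first.
  apply: (@eqO_near_le _ _ _ (K + 1)) => [|n|n|]; rewrite ?exprn_ge0 //.
    exact: ltr_wpDl.
  apply: nearW => n.
  apply: le_trans (errK n) _; rewrite ler_wpM2r ?exprn_ge0 //.
  by rewrite lerDl.
have d_pos : 0 < d%:R :> R[i] by rewrite ltr0n.
have G_pos : 0 < #|G|%:R :> R[i] by rewrite ltr0n cardG_gt0.
pose q := `|c| / d%:R; set M := #|G|%:R in G_pos.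
have q_ge0 : 0 <= q by rewrite divr_ge0 // ltW.
have q_lt1 : q < 1.
  by rewrite ltr_pdivrMr // mul1r; apply: (second_largest_value_lt d_gt0 c_sec).
have e_pos : 0 < (M *+ 2 * (K + 1))^-1.
  by rewrite invr_gt0 mulr_gt0 ?pmulrn_lgt0 // ltr_wpDl.
apply: (@eqO_near_le _ _ _ ((K + 1) * (M *+ 2))) => [|n|n|].
- by rewrite mulr_gt0 ?pmulrn_lgt0 // ltr_wpDl.
- exact: normr_ge0.
- exact: exprn_ge0.
have q01 : 0 <= q < 1 by rewrite q_ge0.
apply: filterS (near_expr_le q01 e_pos) => n qn_le.
rewrite -/q.
have Dc : `|c| ^+ n = q ^+ n * d%:R ^+ n.
  by rewrite -exprMn divfK // gt_eqF.
have err : `|(b n)%:R - a n| <= (K + 1) * (q ^+ n * d%:R ^+ n).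
  rewrite -Dc; apply: le_trans (errK n) _; rewrite ler_wpM2r ?exprn_ge0 //.
  by rewrite lerDl.
have dn_pos : 0 < d%:R ^+ n :> R[i] by rewrite exprn_gt0.
have K1_pos : 0 < K + 1 by rewrite ltr_wpDl.
have M2_pos : 0 < M *+ 2 by rewrite pmulrn_lgt0.
(* The choice of the bound on q ^+ n makes the error at most half of the lower
   bound d^n / #|G| for b n; this is what keeps a n away from 0. *)
have dn_le : d%:R ^+ n <= M *+ 2 * `|a n|.
  have b_ge : d%:R ^+ n <= M * (b n)%:R by apply: nb_irr_tensor_power_ge.
  have err2 : M *+ 2 * `|(b n)%:R - a n| <= d%:R ^+ n.
    apply: le_trans (_ : M *+ 2 * ((K + 1) * (q ^+ n * d%:R ^+ n)) <= _).
      by rewrite ler_pM2l.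
    rewrite !mulrA ler_piMl ?(ltW dn_pos) // -ler_pdivlMl ?mulr_gt0 //.
    by rewrite mulr1.
  have b_le : (b n)%:R <= `|(b n)%:R - a n| + `|a n|.
    rewrite -[leLHS]normr_nat -[X in `|X|](subrK (a n)); exact: ler_normD.
  have : M *+ 2 * (b n)%:R <= M *+ 2 * (`|(b n)%:R - a n| + `|a n|).
    by rewrite ler_pM2l.
  rewrite mulrDr => le2.
  rewrite -(lerD2l (d%:R ^+ n)) -mulr2n.
  apply: le_trans (_ : M *+ 2 * (b n)%:R <= _); first last.
    by apply: le_trans le2 _; rewrite lerD2r.
  by rewrite mulrnAl lerMn2r.
have nz_a : a n != 0.
  rewrite -normr_gt0 -(pmulr_rgt0 _ M2_pos).
  exact: lt_le_trans dn_pos dn_le.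
have -> : (b n)%:R / a n - 1 = ((b n)%:R - a n) / a n.
  by rewrite mulrBl divff.
rewrite normrM normfV ler_pdivrMr ?normr_gt0 //.
apply: le_trans err _.
by rewrite -!mulrA ler_pM2l // [leRHS]mulrCA ler_wpM2l ?exprn_ge0.
Qed.
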